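(* Let $\alpha>0$, $\beta>0$, $\gamma\ge 0$, $0\le\phi\le1$. Each of the following parameter conditions is sufficient for the right-pushed beta density $x\mapsto\text{RPushBeta}(x|\alpha,\beta,\gamma,\phi)$ to be strictly quasi-concave or strictly quasi-convex over its support, as stated: (a) if $\beta\ge 1$ and $\alpha>1$, it is strictly quasi-concave; (b) if $\beta>1$ and $\alpha\ge 1$, it is strictly quasi-concave; (c) if $\beta\ge 1$, $\alpha\ge 1$, $\gamma>0$ and $\phi>0$, it is strictly quasi-concave; (d) if $\beta\le 1$ and $\alpha+\gamma\phi^2<1$, it is strictly quasi-convex; (e) if $\beta\le 1$, $\alpha<1$, $0<\phi<1$ and $\gamma$ is sufficiently small (i.e. there is $\gamma_*>0$ depending on $\alpha,\beta,\phi$ such that this holds for all $0\le\gamma<\gamma_*$), it is strictly quasi-convex.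
   Context: For $\alpha>0$, $\beta>0$, $\gamma\ge 0$, $0\le\phi\le 1$, the right-pushed beta density is $$\text{RPushBeta}(x|\alpha,\beta,\gamma,\phi)=\frac{x^{\alpha-1}(1-x)^{\beta-1}(1-\phi+x\phi)^{\gamma}}{\int_0^1 t^{\alpha-1}(1-t)^{\beta-1}(1-\phi+t\phi)^{\gamma}\,dt},\qquad 0\le x\le 1.$$ Its support is the unit interval; values at the endpoints $0$ and $1$ are understood as limits in $[0,+\infty]$. A function $f$ is strictly quasi-concave if $f(\lambda x+(1-\lambda)y)>\min(f(x),f(y))$ for all $x\ne y$ and $0<\lambda<1$, and strictly quasi-convex if $f(\lambda x+(1-\lambda)y)<\max(f(x),f(y))$ for all $x\neq y$ and $0<\lambda<1$. *)

(* Defs.v *)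
From HB Require Import structures.
From mathcomp Require Import all_boot all_order all_algebra.
From mathcomp Require Import all_classical all_reals all_analysis.
Set Implicit Arguments.
Unset Strict Implicit.
Unset Printing Implicit Defensive.
Import Order.TTheory GRing.Theory Num.Theory.
Import numFieldNormedType.Exports.
Local Open Scope classical_set_scope.
Local Open Scope ring_scope.

Section RPushBeta.
Context {R : realType}.
Implicit Types (alpha beta gamma phi x : R).

(* Since 0 `^ a = 0 for a != 0, this is not the limiting value at x = 0 or
   x = 1 in general; it is only used on ]0, 1[ and, up to a null set, under the
   integral sign. *)
Definition rpush_beta_kernel alpha beta gamma phi x : R :=
  x `^ (alpha - 1) * (1 - x) `^ (beta - 1) * (1 - phi + x * phi) `^ gamma.

Definition rpush_beta_interior alpha beta gamma phi x : R :=
  rpush_beta_kernel alpha beta gamma phi x /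
  Rintegral lebesgue_measure `[0, 1]
    (rpush_beta_kernel alpha beta gamma phi).

(* The endpoint values are the one-sided limits in the extended reals (they may
   be +oo); only the values on [0, 1] are meaningful. *)
Definition rpush_beta alpha beta gamma phi x : \bar R :=
  if x == 0 then
    lim ((rpush_beta_interior alpha beta gamma phi t)%:E @[t --> (0 : R)^'+])
  else if x == 1 then
    lim ((rpush_beta_interior alpha beta gamma phi t)%:E @[t --> (1 : R)^'-])
  else (rpush_beta_interior alpha beta gamma phi x)%:E.

Definition strictly_quasi_concave_on (D : set R) (f : R -> \bar R) : Prop :=
  forall x y l : R, D x -> D y -> x != y -> 0 < l < 1 ->
    (Order.min (f x) (f y) < f (l * x + (1 - l) * y)%R)%E.

Definition strictly_quasi_convex_on (D : set R) (f : R -> \bar R) : Prop :=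
  forall x y l : R, D x -> D y -> x != y -> 0 < l < 1 ->
    (f (l * x + (1 - l) * y)%R < Order.max (f x) (f y))%E.

End RPushBeta.

(* Main.v *)
Require Import Defs.
From HB Require Import structures.
From mathcomp Require Import all_boot all_order all_algebra.
From mathcomp Require Import all_classical all_reals all_analysis.
From mathcomp Require Import measurable_realfun ring lra.

(** The normalizing integral is positive and finite because the kernel is
    bounded by a multiple of [x^(alpha-1) + (1-x)^(beta-1)], so only the kernel
    matters. In (a)-(c) it is a product of nonnegative powers of affine
    functions, one of them strict, and weighted AM-GM makes it strictly
    log-concave on the closed interval. In (d) the derivative of its logarithm
    is strictly increasing, so comparing the mean value theorem on [x, m] and
    on [m, y] excludes an interior value reaching both end values; endpoints
    where the density blows up are trivial. Part (e) is (d) with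
    [gamma_star = (1 - alpha) / phi^2]. *)

Set Implicit Arguments.
Unset Strict Implicit.
Unset Printing Implicit Defensive.
Import Order.TTheory GRing.Theory Num.Theory.
Import numFieldNormedType.Exports.
Local Open Scope classical_set_scope.
Local Open Scope ring_scope.

(** * Weighted AM-GM and real powers *)

Section powR_facts.
Context {R : realType}.
Implicit Types (p q l u v x : R).

Lemma lt_lnB1 x : 0 < x -> x != 1 -> ln x < x - 1.
Proof.
move=> x0 x1; rewrite -ltr_expR lnK ?posrE//.
by rewrite -[ltLHS](subrKC 1) expR_gt1Dx// subr_eq0.
Qed.

(** With [m] the arithmetic mean, apply [ln x < x - 1] at [u / m] and [v / m] and average with
    weights [l] and [1 - l]. If [u] or [v] is zero, the left side vanishes while the right side
    stays positive. *)
Lemma powR_strict_AM_GM l u v : 0 < l < 1 -> 0 <= u -> 0 <= v -> u != v ->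
  u `^ l * v `^ (1 - l) < l * u + (1 - l) * v.
Proof.
move=> /andP[l0 l1] u0 v0 uv.
have l1' : 0 < 1 - l by rewrite subr_gt0.
have [u_eq0|u_neq0] := eqVneq u 0.
  rewrite u_eq0 powR0 ?gt_eqF// mul0r mulr0 add0r mulr_gt0// lt_neqAle v0.
  by rewrite -u_eq0 uv.
have [v_eq0|v_neq0] := eqVneq v 0.
  by rewrite v_eq0 powR0 ?gt_eqF// !mulr0 addr0 mulr_gt0// lt_neqAle eq_sym u_neq0.
have {}u0 : 0 < u by rewrite lt_neqAle eq_sym u_neq0.
have {}v0 : 0 < v by rewrite lt_neqAle eq_sym v_neq0.
set m := l * u + (1 - l) * v.
have m0 : 0 < m by rewrite addr_gt0 ?mulr_gt0.
(* Both weights are positive, so the mean can equal [u] or [v] only if [u = v]. *)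
have mne w : w = u \/ w = v -> w / m != 1.
  move=> wuv; apply: contra_neq uv => /divr1_eq.
  rewrite /m; case: wuv => -> h.
  - have : (1 - l) * (u - v) = 0 by lra.
    by move/eqP; rewrite mulf_eq0 gt_eqF//= subr_eq0 => /eqP.
  - have : l * (u - v) = 0 by lra.
    by move/eqP; rewrite mulf_eq0 gt_eqF//= subr_eq0 => /eqP.
have hu := lt_lnB1 (divr_gt0 u0 m0) (mne _ (or_introl erefl)).
have hv := lt_lnB1 (divr_gt0 v0 m0) (mne _ (or_intror erefl)).
rewrite !ln_div ?posrE// in hu hv.
rewrite -ltr_ln ?posrE// ?mulr_gt0 ?powR_gt0// lnM ?posrE ?powR_gt0//.
rewrite !ln_powR.
have : l * (ln u - ln m) + (1 - l) * (ln v - ln m) <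
    l * (u / m - 1) + (1 - l) * (v / m - 1).
  by rewrite ltrD// ltr_pM2l.
(* The averaged right sides cancel, because [m] is the mean of [u] and [v]. *)
have -> : l * (u / m - 1) + (1 - l) * (v / m - 1) = m / m - 1.
  by rewrite {3}/m; field; rewrite gt_eqF.
by rewrite divff ?gt_eqF//; lra.
Qed.

(** This is log-concavity of the [p]-th power in multiplicative form, which stays meaningful where
    the power vanishes. It follows by raising AM-GM to the power [p]. *)
Lemma powR_AM_GM_le p l u v : 0 <= p -> 0 < l < 1 -> 0 <= u -> 0 <= v ->
  (u `^ p) `^ l * (v `^ p) `^ (1 - l) <= (l * u + (1 - l) * v) `^ p.
Proof.
move=> p0 l01 u0 v0; have /andP[l0 l1] := l01.
rewrite (powRAC u) (powRAC v) -powRM ?powR_ge0//.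
rewrite ge0_ler_powR// ?nnegrE ?mulr_ge0 ?powR_ge0//.
  by rewrite addr_ge0 ?mulr_ge0 ?subr_ge0// ltW.
have [<-|uv] := eqVneq u v; last exact/ltW/powR_strict_AM_GM.
rewrite -mulrDl subrKC mul1r -powRD ?subrKC ?powRr1//.
by rewrite oner_eq0.
Qed.

Lemma powR_AM_GM_lt p l u v : 0 < p -> 0 < l < 1 -> 0 <= u -> 0 <= v ->
  u != v ->
  (u `^ p) `^ l * (v `^ p) `^ (1 - l) < (l * u + (1 - l) * v) `^ p.
Proof.
move=> p0 l01 u0 v0 uv; have /andP[l0 l1] := l01.
rewrite (powRAC u) (powRAC v) -powRM ?powR_ge0//.
rewrite gt0_ltr_powR// ?nnegrE ?mulr_ge0 ?powR_ge0//.
  by rewrite addr_ge0 ?mulr_ge0 ?subr_ge0// ltW.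
exact: powR_strict_AM_GM.
Qed.

(** Used to pass from log-concavity to quasi-concavity: replacing both entries of a weighted
    geometric mean by their minimum can only decrease it. *)
Lemma min_le_powR_mean l u v : 0 <= l <= 1 -> 0 <= u -> 0 <= v ->
  Num.min u v <= u `^ l * v `^ (1 - l).
Proof.
move=> /andP[l0 l1] u0 v0; set m := Num.min u v.
have m0 : 0 <= m by rewrite le_min u0.
have -> : m = m `^ l * m `^ (1 - l).
  by rewrite -powRD ?subrKC ?powRr1// oner_eq0.
rewrite ler_pM ?powR_ge0// ge0_ler_powR ?nnegrE// ?subr_ge0//.
- by rewrite ge_min lexx.
- by rewrite ge_min lexx orbT.
Qed.

(** The absolute value makes continuity at 0 two-sided, so one-sided limits at the end points of the
    support can be read off from a function continuous on the whole line. *)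
Lemma continuous_normr_powR p : 0 <= p -> continuous (fun x : R => `|x| `^ p).
Proof.
move=> p0 x.
have [->|pneq0] := eqVneq p 0.
  by under eq_fun do rewrite powRr0; exact: cvg_cst.
have {}p0 : 0 < p by rewrite lt_neqAle eq_sym pneq0.
have [->|x0] := eqVneq x 0.
  apply/cvgrPdist_lt => e e0; rewrite normr0 powR0 ?gt_eqF//.
  have ep : 0 < e `^ p^-1 by rewrite powR_gt0.
  apply/nbhs_ballP; exists (e `^ p^-1) => //= y.
  rewrite /ball/= sub0r normrN => ye.
  rewrite sub0r normrN ger0_norm ?powR_ge0//.
  rewrite -[ltRHS]powRr1 ?ltW// -(@mulVf _ p) ?gt_eqF// powRrM.
  by rewrite gt0_ltr_powR// nnegrE ?powR_ge0.
apply: (@cvg_comp _ _ _ (fun x => `|x|) (fun x => x `^ p) _ (nbhs `|x|)).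
  exact: norm_continuous.
have : derivable (fun x : R => x `^ p) `|x| 1.
  by apply: ex_derive; apply: is_derive1_powR; rewrite normr_gt0.
by move/derivable1_diffP/differentiable_continuous.
Qed.

End powR_facts.

(** * An integrable majorant of the beta kernel *)

Section integrability.
Context {R : realType}.
Local Notation mu := (@lebesgue_measure R).
Implicit Types (f F : R -> R) (a b s x : R).

(** The fundamental theorem of calculus on compact subintervals, followed by monotone convergence.
    Only bounds on the antiderivative are asked for, so [f] may blow up at both ends. *)
Lemma ge0_integral_itvoo_le f F a b m M : a < b ->
  {in `]a, b[, forall x, 0 <= f x} ->
  {in `]a, b[, continuous f} ->
  {in `]a, b[, forall x, is_derive x 1 F (f x)} ->
  {in `]a, b[, forall x, m <= F x <= M} ->
  (\int[mu]_(x in `]a, b[) (f x)%:E <= (M - m)%:E)%E.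
Proof.
move=> ab f0 cf dF FmM.
(* The margin is at most a third of the length, so every truncated interval is nondegenerate,
   including the one for [n = 0]. *)
pose h n : R := (b - a) / n.+3%:R.
have h0 n : 0 < h n by rewrite divr_gt0// subr_gt0.
have hlt n : a + h n < b - h n.
  suff : 2 * h n < b - a by lra.
  by rewrite mulrA ltr_pdivrMr// mulrC ltr_pM2l ?subr_gt0// ltr_nat.
have hle n k : (n <= k)%N -> h k <= h n.
  by move=> nk; rewrite ler_pM2l ?subr_gt0// lef_pV2 ?posrE// ler_nat.
pose E n := `[a + h n, b - h n]%classic.
have Esub n x : x \in `[a + h n, b - h n]%R -> x \in `]a, b[%R.
  rewrite !in_itv/=; have := h0 n => hn /andP[? ?].
  by apply/andP; split; lra.
have ndE : nondecreasing_seq E.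
  move=> n k nk; rewrite subsetEset => x; rewrite /E/= !in_itv/=.
  by have := hle _ _ nk => ? /andP[? ?]; apply/andP; split; lra.
have mfab : measurable_fun `]a, b[ f.
  apply: open_continuous_measurable_fun; first exact: interval_open.
  by move=> x; rewrite inE => /cf.
have UE : `]a, b[%classic = \bigcup_n E n.
  rewrite eqEsubset; split=> [x/=|x [n _] /Esub//].
  rewrite in_itv/= => /andP[ax xb].
  (* A point at distance [d] from the nearer end lies in [E n] as soon as the margin [h n] is at
     most [d]. *)
  pose d := Num.min (x - a) (b - x).
  have d0 : 0 < d by rewrite lt_min !subr_gt0 ax.
  have dxa : d <= x - a by rewrite ge_min lexx.
  have dxb : d <= b - x by rewrite ge_min lexx orbT.
  exists (Num.truncn ((b - a) / d)) => //.
  set n := Num.truncn _.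
  have hnd : h n <= d.
    rewrite ler_pdivrMr// mulrC -ler_pdivrMr// (le_trans (ltW (truncnS_gt _)))//.
    by rewrite ler_nat ltnW// ltnW.
  by rewrite /E/= in_itv/=; apply/andP; split; lra.
have cE : (\int[mu]_(x in E n) (f x)%:E)%E @[n --> \oo] -->
    (\int[mu]_(x in \bigcup_n E n) (f x)%:E)%E.
  apply: (@ge0_nondecreasing_set_cvg_integral _ (measurableTypeR R) R E
    (EFin \o f) mu) => //.
  - by move=> n; exact: measurable_itv.
  - move=> n; apply/measurable_EFinP; apply: measurable_funS mfab => //.
    by move=> x /Esub.
  - by move=> n x /Esub xab; rewrite lee_fin f0.
rewrite UE; apply: (cvge_to_le cE).
apply: nearW => n.
rewrite (@continuous_FTC2 _ f F) ?hlt//.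
- rewrite -EFinB lee_fin lerB//.
  + suff: b - h n \in `]a, b[ by move/FmM/andP => [].
    by apply: (Esub n); rewrite in_itv/= lexx ltW.
  + suff: a + h n \in `]a, b[ by move/FmM/andP => [].
    by apply: (Esub n); rewrite in_itv/= lexx ltW.
- apply: continuous_in_subspaceT => x; rewrite inE => /Esub; exact: cf.
- have cF x : x \in `[a + h n, b - h n] -> {for x, continuous F}.
    move=> /Esub/dF[dFx _]; apply/differentiable_continuous.
    exact/derivable1_diffP.
  split.
  + by move=> x /subset_itv_oo_cc/Esub/dF[].
  + by apply: cvg_at_right_filter; apply: cF; rewrite in_itv/= lexx ltW.
  + by apply: cvg_at_left_filter; apply: cF; rewrite in_itv/= lexx ltW.
- by move=> x /subset_itv_oo_cc/Esub/dF[_ <-]; rewrite derive1E.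
Qed.

(** The summand 1 is the bound for a nonnegative exponent, the other summand the bound for a
    negative one; adding them avoids a case distinction later. *)
Lemma powR_le_half s u : 2^-1 <= u <= 1 -> u `^ s <= 1 + 2^-1 `^ s.
Proof.
move=> /andP[u2 u1].
have u0 : 0 < u by rewrite (lt_le_trans _ u2).
have [s0|s0] := leP 0 s.
  rewrite ler_wpDr ?powR_ge0// -[leRHS](powRr0 u) ger_powR//.
  by rewrite u0.
rewrite ler_wpDl// -[s]opprK !(powRN _ (- s)) lef_pV2 ?posrE ?powR_gt0//.
by rewrite ge0_ler_powR ?nnegrE ?oppr_ge0 ?invr_ge0 ?(ltW s0) ?(ltW u0).
Qed.

(** On each half of the interval one of the two bases is at least one half, so its power is bounded
    by [powR_le_half], and the other power is a summand on the right. *)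
Lemma beta_kernel_le a b x : 0 <= x <= 1 ->
  x `^ (a - 1) * (1 - x) `^ (b - 1) <=
  (2 + 2^-1 `^ (a - 1) + 2^-1 `^ (b - 1)) * (x `^ (a - 1) + (1 - x) `^ (b - 1)).
Proof.
move=> /andP[x0 x1].
have pa : 0 <= x `^ (a - 1) by exact: powR_ge0.
have pb : 0 <= (1 - x) `^ (b - 1) by exact: powR_ge0.
have ha : 0 <= (2^-1 : R) `^ (a - 1) by exact: powR_ge0.
have hb : 0 <= (2^-1 : R) `^ (b - 1) by exact: powR_ge0.
have prod_le (u v h k : R) : 0 <= u -> 0 <= v -> 0 <= h -> 0 <= k ->
    v <= 1 + h -> u * v <= (2 + k + h) * (u + v).
  move=> u0 v0 h0 k0 vh; rewrite (le_trans (ler_wpM2l u0 vh))// mulrC.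
  by rewrite ler_pM//; lra.
have [x2|x2] := leP x 2^-1.
- have : (1 - x) `^ (b - 1) <= 1 + 2^-1 `^ (b - 1).
    by apply: powR_le_half; apply/andP; split; lra.
  exact: prod_le.
- have : x `^ (a - 1) <= 1 + 2^-1 `^ (a - 1).
    by apply: powR_le_half; apply/andP; split; lra.
  by rewrite mulrC [2 + _ + _]addrAC [_ `^ _ + _]addrC; exact: prod_le.
Qed.

Lemma is_derive_affine (c d x : R) : is_derive x 1 (fun t => c + t * d) d.
Proof.
have -> : (fun t : R => c + t * d) = cst c + d \*: (id : R -> R^o).
  by apply/funext => t; rewrite /= [t * d]mulrC.
have H : is_derive x 1 (cst c + d \*: (id : R -> R^o)) (0 + d *: (1 : R^o)).
  by apply: is_deriveD; apply: is_deriveZ.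
by move: H; rewrite add0r [d *: _]mulr1.
Qed.

Lemma integral_beta_majorant_le a b : 0 < a -> 0 < b ->
  (\int[mu]_(x in `]0%R, 1%R[) (x `^ (a - 1) + (1 - x) `^ (b - 1))%:E <=
   (a^-1 + b^-1)%:E)%E.
Proof.
move=> a0 b0.
have dpow (t c : R) : 0 < t -> 0 < c ->
    is_derive t 1 (fun t => t `^ c / c) (t `^ (c - 1)).
  move=> t0 c0.
  have -> : t `^ (c - 1) = c^-1 *: (c * t `^ (c - 1)).
    by rewrite [RHS]mulrA mulVf ?gt_eqF// mul1r.
  have -> : (fun t => t `^ c / c) = c^-1 *: (fun t : R => t `^ c).
    by apply/funext => y; rewrite [LHS]mulrC.
  by apply: is_deriveZ; exact: is_derive1_powR.
have cpow (t c : R) : 0 < t -> {for t, continuous (fun t : R => t `^ c)}.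
  move=> t0; apply/differentiable_continuous/derivable1_diffP.
  by apply: ex_derive; exact: is_derive1_powR.
(* The antiderivative below takes values between [- b^-1] and [a^-1]; the double negation exhibits
   the bound as the difference of the two. *)
rewrite -[X in (_ + X)%:E]opprK.
apply: (@ge0_integral_itvoo_le _ (fun x => x `^ a / a - (1 - x) `^ b / b)) => //.
- by move=> x _; rewrite addr_ge0 ?powR_ge0.
- move=> x; rewrite in_itv/= => /andP[x0 x1].
  apply: cvgD; first exact: cpow.
  apply: (@continuous_comp _ _ _ (fun x => 1 - x) (fun t => t `^ (b - 1))).
    by apply: continuousB => //; exact: cvg_cst.
  by apply: cpow; rewrite subr_gt0.
- move=> x; rewrite in_itv/= => /andP[x0 x1].
  have -> : x `^ (a - 1) + (1 - x) `^ (b - 1) =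
      x `^ (a - 1) - (1 - x) `^ (b - 1) * (-1) by rewrite mulrN1 opprK.
  apply: is_deriveB; first exact: dpow.
  apply: (@is_derive1_comp _ (fun t => t `^ b / b) (fun x => 1 - x)).
    by apply: dpow => //; rewrite subr_gt0.
  have -> : (fun t => 1 - t) = (fun t : R => 1 + t * (-1)).
    by apply/funext => t; rewrite mulrN1.
  exact: is_derive_affine.
- move=> x; rewrite in_itv/= => /andP[x0 x1].
  have le_inv (t c : R) : 0 < c -> 0 < t < 1 -> 0 <= t `^ c / c <= c^-1.
    move=> c0 /andP[t0 t1]; rewrite divr_ge0 ?powR_ge0 ?(ltW c0)//=.
    rewrite ler_pdivrMr// mulVf ?gt_eqF//.
    have := @ge0_ler_powR _ c (ltW c0) t 1; rewrite powR1; apply; last exact: ltW.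
    - by rewrite nnegrE ltW.
    - by rewrite nnegrE.
  have := le_inv x a a0; rewrite x0 x1 => /(_ isT)/andP[? ?].
  have := le_inv (1 - x) b b0; rewrite subr_gt0 x1 => /(_ _)/andP[|? ?].
    by rewrite gtrBl.
  by apply/andP; split; lra.
Qed.

End integrability.

(** * Positivity and finiteness of the normalizing integral *)

Section normalizer.
Context {R : realType}.
Local Notation mu := (@lebesgue_measure R).
Implicit Types (alpha beta gamma phi x : R).

(** The difference of the two sides is [(1 - phi) * (1 - x)]. Besides giving positivity of the push
    factor, this is the bound used to compare derivatives and to estimate the density near 1. *)
Lemma le_push_factor phi x : 0 <= phi <= 1 -> x <= 1 -> x <= 1 - phi + x * phi.
Proof.
move=> /andP[p0 p1] x1; rewrite -subr_ge0.
have -> : 1 - phi + x * phi - x = (1 - phi) * (1 - x) by ring.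
by rewrite mulr_ge0// subr_ge0.
Qed.

Lemma push_factor_le1 phi x : 0 <= phi <= 1 -> x <= 1 -> 1 - phi + x * phi <= 1.
Proof.
by move=> /andP[p0 p1] x1; rewrite -subr_ge0 opprD opprB addrA; nra.
Qed.

Lemma rpush_beta_kernel_ge0 alpha beta gamma phi x :
  0 <= rpush_beta_kernel alpha beta gamma phi x.
Proof. by rewrite /rpush_beta_kernel !mulr_ge0 ?powR_ge0. Qed.

Lemma rpush_beta_kernel_gt0 alpha beta gamma phi x :
  0 <= phi <= 1 -> 0 < x < 1 -> 0 < rpush_beta_kernel alpha beta gamma phi x.
Proof.
move=> p01 /andP[x0 x1]; rewrite /rpush_beta_kernel !mulr_gt0 ?powR_gt0//.
  by rewrite subr_gt0.
by rewrite (lt_le_trans x0)// le_push_factor// ltW.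
Qed.

Lemma measurable_rpush_beta_kernel alpha beta gamma phi :
  measurable_fun setT (rpush_beta_kernel alpha beta gamma phi).
Proof.
apply: measurable_funM; first apply: measurable_funM.
- exact: measurable_powR.
- apply: (measurableT_comp (measurable_powR _)).
  exact: measurable_funB.
- apply: (measurableT_comp (measurable_powR _)).
  by apply: measurable_funD => //; exact: measurable_funM.
Qed.

(** [Rintegral] is the finite part of an extended integral and would be 0 if that integral were
    infinite, so finiteness has to be shown along with positivity. A zero integral would make the
    kernel vanish almost everywhere on an interval of measure 1 where it is positive. *)
Lemma Rintegral_rpush_beta_kernel_gt0 alpha beta gamma phi :
  0 < alpha -> 0 < beta -> 0 <= gamma -> 0 <= phi <= 1 ->
  0 < Rintegral mu `[0, 1] (rpush_beta_kernel alpha beta gamma phi).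
Proof.
move=> a0 b0 g0 p01; rewrite /Rintegral.
set k := rpush_beta_kernel _ _ _ _.
have mk : measurable_fun (`]0, 1[%classic : set R) (EFin \o k).
  by apply/measurable_EFinP; apply: measurable_funTS; exact: measurable_rpush_beta_kernel.
rewrite integral_itv_bndoo//; apply: fine_gt0; apply/andP; split.
- rewrite lt_neqAle integral_ge0 ?andbT; last first.
    by move=> x _; rewrite lee_fin rpush_beta_kernel_ge0.
  apply/negP => /eqP/esym I0.
  have : (\int[mu]_(x in `]0%R, 1%R[) `|(k x)%:E|)%E = 0%E.
    rewrite -[RHS]I0; apply: eq_integral => x _.
    by rewrite gee0_abs// lee_fin rpush_beta_kernel_ge0.
  move/(ae_eq_integral_abs mu (measurable_itv _) mk) => [N [mN N0 subN]].
  have sub01 : `]0%R, 1%R[%classic `<=` N.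
    move=> x x01; apply: subN => /= /(_ x01)/eqP.
    by rewrite eqe gt_eqF// rpush_beta_kernel_gt0//; move: x01; rewrite /= in_itv.
  have : (mu `]0%R, 1%R[%classic <= mu N)%E.
    by apply: le_measure => //; rewrite inE//; exact: measurable_itv.
  by rewrite lebesgue_measure_itv/= lte_fin ltr01 N0 oppr0 adde0 lee_fin ler10.
- set C := 2 + 2^-1 `^ (alpha - 1) + 2^-1 `^ (beta - 1).
  pose h x := x `^ (alpha - 1) + (1 - x) `^ (beta - 1).
  have h_ge0 x : 0 <= h x by rewrite addr_ge0 ?powR_ge0.
  have C0 : 0 <= C by rewrite !addr_ge0 ?powR_ge0.
  have mh : measurable_fun (`]0, 1[%classic : set R) h.
    apply: measurable_funTS; apply: measurable_funD; first exact: measurable_powR.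
    by apply: (measurableT_comp (measurable_powR _)); exact: measurable_funB.
  apply: (@le_lt_trans _ _ (\int[mu]_(x in `]0%R, 1%R[) (C%:E * (h x)%:E))%E).
    apply: ge0_le_integral => //.
    + by move=> x _; rewrite lee_fin rpush_beta_kernel_ge0.
    + by apply/measurable_EFinP; exact: measurable_funM.
    + move=> x; rewrite /= in_itv/= => /andP[x0 x1].
      rewrite -EFinM lee_fin (le_trans _ (beta_kernel_le _ _ _))//; last first.
        by rewrite !ltW.
      rewrite ler_piMr ?mulr_ge0 ?powR_ge0// -[leRHS](powRr0 (1 - phi + x * phi)).
      rewrite ger_powR// push_factor_le1 ?(ltW x1)// andbT.
      by rewrite (lt_le_trans x0)// le_push_factor// ltW.
  rewrite ge0_integralZl//=; last first.
  + by move=> x _; rewrite lee_fin.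
  + exact/measurable_EFinP.
  apply: (@le_lt_trans _ _ (C%:E * (alpha^-1 + beta^-1)%:E)%E); last first.
    by rewrite -EFinM ltry.
  by apply: lee_wpmul2l => //; exact: integral_beta_majorant_le.
Qed.

End normalizer.

(** * Strict quasi-concavity, cases (a) to (c) *)

Section quasi_concavity.
Context {R : realType}.
Implicit Types (alpha beta gamma phi x y l : R).

Lemma convex_comb_itvoo x y l : 0 <= x <= 1 -> 0 <= y <= 1 -> x != y -> 0 < l < 1 ->
  0 < l * x + (1 - l) * y < 1.
Proof.
move=> /andP[x0 x1] /andP[y0 y1] xy /andP[l0 l1].
have : x != y := xy; rewrite neq_lt => /orP[?|?]; apply/andP; split; nra.
Qed.

(** The smaller factors are only nonnegative, since a factor of the kernel may vanish at an end
    point of the support. *)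
Lemma ltr_pM3 (a b c a' b' c' : R) : 0 <= a' -> 0 <= b' -> 0 <= c' ->
  0 < a -> 0 < b -> 0 < c -> a' <= a -> b' <= b -> c' <= c ->
  [|| a' < a, b' < b | c' < c] -> a' * b' * c' < a * b * c.
Proof.
move=> a'0 b'0 c'0 a0 b0 c0 aa bb cc.
have le3 : a' * b' <= a * b by rewrite ler_pM.
case/or3P => [lt|lt|lt].
- rewrite (@le_lt_trans _ _ (a' * b * c))//.
    by rewrite ler_pM ?mulr_ge0// ler_wpM2l.
  by rewrite ltr_pM2r// ltr_pM2r.
- rewrite (@le_lt_trans _ _ (a * b' * c))//.
    by rewrite ler_pM ?mulr_ge0// ler_wpM2r.
  by rewrite ltr_pM2r// ltr_pM2l.
- rewrite (@le_lt_trans _ _ (a * b * c'))//.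
    by rewrite ler_wpM2r.
  by rewrite ltr_pM2l// mulr_gt0.
Qed.

Lemma rpush_beta_kernel_AM_GM alpha beta gamma phi x y l :
  0 <= phi <= 1 -> 1 <= alpha -> 1 <= beta -> 0 <= gamma ->
  [|| 1 < alpha, 1 < beta | (0 < gamma) && (0 < phi)] ->
  0 <= x <= 1 -> 0 <= y <= 1 -> x != y -> 0 < l < 1 ->
  rpush_beta_kernel alpha beta gamma phi x `^ l *
    rpush_beta_kernel alpha beta gamma phi y `^ (1 - l) <
  rpush_beta_kernel alpha beta gamma phi (l * x + (1 - l) * y).
Proof.
move=> p01 a1 b1 g0 strict x01 y01 xy l01.
have /andP[m0 m1] := convex_comb_itvoo x01 y01 xy l01.
have /andP[x0 x1] := x01; have /andP[y0 y1] := y01.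
have Lx := le_trans x0 (le_push_factor p01 x1).
have Ly := le_trans y0 (le_push_factor p01 y1).
rewrite /rpush_beta_kernel; set m := l * x + (1 - l) * y.
(* The bases are affine, so their values at [m] are the weighted means of their values at [x] and
   [y]. *)
have E1 : 1 - m = l * (1 - x) + (1 - l) * (1 - y) by rewrite /m; ring.
have E2 : 1 - phi + m * phi =
    l * (1 - phi + x * phi) + (1 - l) * (1 - phi + y * phi) by rewrite /m; ring.
have m1' : 0 < 1 - m by rewrite subr_gt0.
have Lm : 0 < 1 - phi + m * phi.
  by rewrite (lt_le_trans m0)// le_push_factor// ltW.
rewrite !powRM ?mulr_ge0 ?powR_ge0//.
rewrite (_ : forall a b c d e f : R,
  a * b * c * (d * e * f) = (a * d) * (b * e) * (c * f)); last first.
  by move=> *; ring.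
apply: ltr_pM3; rewrite ?mulr_ge0 ?powR_ge0 ?powR_gt0//.
- by apply: powR_AM_GM_le; rewrite ?subr_ge0.
- by rewrite E1; apply: powR_AM_GM_le; rewrite ?subr_ge0.
- by rewrite E2; apply: powR_AM_GM_le.
(* Strictness comes from one factor with positive exponent whose base separates [x] and [y]; for the
   push factor this separation is where [phi > 0] enters. *)
case/or3P: strict => [lt|lt|/andP[lt ltp]]; apply/or3P.
- by apply: Or31; apply: powR_AM_GM_lt; rewrite ?subr_gt0.
- apply: Or32; rewrite E1; apply: powR_AM_GM_lt; rewrite ?subr_gt0 ?subr_ge0//.
  by rewrite (inj_eq (subrI _)).
- apply: Or33; rewrite E2; apply: powR_AM_GM_lt => //.
  by rewrite (inj_eq (addrI _)) (inj_eq (mulIf _))// gt_eqF.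
Qed.

Lemma rpush_beta_itvooE alpha beta gamma phi x : 0 < x < 1 ->
  rpush_beta alpha beta gamma phi x =
  (rpush_beta_interior alpha beta gamma phi x)%:E.
Proof. by move=> /andP[x0 x1]; rewrite /rpush_beta gt_eqF// lt_eqF. Qed.

(** All exponents being nonnegative, the kernel agrees on the closed interval with the continuous
    function [K], so the limits at the end points are its values there. For a zero exponent the
    convention that 0 to the power 0 is 1 gives the right value. *)
Lemma rpush_beta_itvccE alpha beta gamma phi x :
  0 <= phi <= 1 -> 1 <= alpha -> 1 <= beta -> 0 <= gamma -> 0 <= x <= 1 ->
  rpush_beta alpha beta gamma phi x =
  (rpush_beta_interior alpha beta gamma phi x)%:E.
Proof.
move=> p01 a1 b1 g0 x01.
pose K t := `|t| `^ (alpha - 1) * `|1 - t| `^ (beta - 1) *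
  `|1 - phi + t * phi| `^ gamma.
have cK : continuous K.
  have caff (c d t : R) : (fun t => c + t * d) @ t --> c + t * d.
    have [+ _] := is_derive_affine c d t.
    by move/derivable1_diffP/differentiable_continuous.
  move=> t; apply: cvgM; first apply: cvgM.
  - by apply: continuous_normr_powR; rewrite subr_ge0.
  - apply: (@cvg_comp _ _ _ (fun t => 1 - t) (fun t => `|t| `^ (beta - 1))).
      by apply: cvgB; [exact: cvg_cst|exact: cvg_id].
    by apply: continuous_normr_powR; rewrite subr_ge0.
  - apply: (@cvg_comp _ _ _ (fun t => 1 - phi + t * phi)
      (fun t => `|t| `^ gamma)); first exact: caff.
    exact: continuous_normr_powR.
have KE t : 0 <= t <= 1 -> rpush_beta_kernel alpha beta gamma phi t = K t.
  move=> /andP[t0 t1]; rewrite /K /rpush_beta_kernel !ger0_norm ?subr_ge0//.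
  exact: le_trans t0 (le_push_factor p01 t1).
have limE (F : set_system R) (c : R) : ProperFilter F -> F --> c ->
    (\forall t \near F, 0 <= t <= 1) -> 0 <= c <= 1 ->
    lim ((rpush_beta_interior alpha beta gamma phi t)%:E @[t --> F]) =
    (rpush_beta_interior alpha beta gamma phi c)%:E.
  move=> PF Fc F01 c01; apply/cvg_lim => //.
  apply: cvg_EFin; first exact: nearW.
  rewrite /rpush_beta_interior KE//.
  apply: cvgM; last exact: cvg_cst.
  apply: cvg_trans (cvg_comp _ _ Fc (cK c)).
  apply: near_eq_cvg; near=> t; rewrite KE//; near: t; exact: F01.
rewrite /rpush_beta; case: eqP => [->|_].
  apply: limE; [exact: cvg_at_right_filter| |by rewrite lexx ler01].
  near=> t; apply/andP; split; apply/ltW; near: t; first exact: nbhs_right_gt.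
  exact: nbhs_right_lt.
case: eqP => [->|_]//.
apply: limE; [exact: cvg_at_left_filter| |by rewrite lexx ler01].
near=> t; apply/andP; split; apply/ltW; near: t; first exact: nbhs_left_gt.
exact: nbhs_left_lt.
Unshelve. all: by end_near. Qed.

Lemma strictly_quasi_concave_rpush_beta alpha beta gamma phi :
  0 <= phi <= 1 -> 1 <= alpha -> 1 <= beta -> 0 <= gamma ->
  [|| 1 < alpha, 1 < beta | (0 < gamma) && (0 < phi)] ->
  strictly_quasi_concave_on `[0, 1] (rpush_beta alpha beta gamma phi).
Proof.
move=> p01 a1 b1 g0 strict x y l; rewrite /= !in_itv/= => x01 y01 xy l01.
rewrite (rpush_beta_itvooE _ _ _ _ (convex_comb_itvoo x01 y01 xy l01)).
rewrite !rpush_beta_itvccE// gt_min !lte_fin -gt_min.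
have Z0 := Rintegral_rpush_beta_kernel_gt0 (lt_le_trans ltr01 a1)
  (lt_le_trans ltr01 b1) g0 p01.
rewrite /rpush_beta_interior -minr_pMl ?invr_ge0 ?(ltW Z0)// ltr_pM2r ?invr_gt0//.
apply: le_lt_trans (rpush_beta_kernel_AM_GM p01 a1 b1 g0 strict x01 y01 xy l01).
have /andP[l0 l1] := l01.
by apply: min_le_powR_mean; rewrite ?rpush_beta_kernel_ge0// (ltW l0) ltW.
Qed.

End quasi_concavity.

(** * Strict quasi-convexity, cases (d) and (e) *)

Section quasi_convexity.
Context {R : realType}.
Implicit Types (alpha beta gamma phi x y l s t : R).

(** Derivability is asked for only in the open interval, so that [y] may be the end point 1 of the
    support. *)
Lemma lt_max_of_increasing_derive (f df : R -> R) x m y : x < m < y ->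
  {in `]x, y[, forall t, is_derive t 1 f (df t)} ->
  {in `[x, y], continuous f} ->
  {in `]x, y[ &, {homo df : s t / s < t}} ->
  f m < Num.max (f x) (f y).
Proof.
move=> /andP[xm my] fdf cf incr.
have in_oo t : x < t < y -> t \in `]x, y[ by rewrite in_itv.
have cf' a b : x <= a -> b <= y -> {within `[a, b], continuous f}.
  move=> xa b_y; apply: continuous_in_subspaceT => t.
  rewrite inE/= in_itv/= => /andP[a_t tb]; apply: cf.
  by rewrite in_itv/= (le_trans xa)//= (le_trans tb).
have [||c1 + fc1] := @MVT R f df x m xm.
- by move=> t; rewrite in_itv/= => /andP[? ?]; apply: fdf; apply: in_oo; lra.
- by apply: cf' => //; exact: ltW.
rewrite in_itv/= => /andP[xc1 c1m].
have [||c2 + fc2] := @MVT R f df m y my.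
- by move=> t; rewrite in_itv/= => /andP[? ?]; apply: fdf; apply: in_oo; lra.
- by apply: cf' => //; exact: ltW.
rewrite in_itv/= => /andP[mc2 c2y].
have df12 : df c1 < df c2.
  by apply: incr; [apply: in_oo; lra|apply: in_oo; lra|lra].
rewrite ltNge ge_max; apply/negP => /andP[fxm fym].
have : 0 <= df c1 * (m - x) by rewrite -fc1 subr_ge0.
rewrite pmulr_lge0 ?subr_gt0// => df1.
have : df c2 * (y - m) <= 0 by rewrite -fc2 subr_le0.
by rewrite pmulr_lle0 ?subr_gt0//; lra.
Qed.

Definition ln_rpush_beta_kernel alpha beta gamma phi (t : R) : R :=
  (alpha - 1) * ln t + (beta - 1) * ln (1 - t) + gamma * ln (1 - phi + t * phi).

Definition dln_rpush_beta_kernel alpha beta gamma phi (t : R) : R :=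
  (alpha - 1) / t - (beta - 1) / (1 - t) + gamma * (phi / (1 - phi + t * phi)).

(** The extra case is the right end point when the density stays finite there: for [beta = 1] the
    factor in [1 - t] is 1 even at [t = 1], and the matching logarithmic term has coefficient 0. *)
Lemma rpush_beta_kernel_expR alpha beta gamma phi t :
  0 <= phi <= 1 -> 0 < t < 1 \/ t = 1 /\ beta = 1 ->
  rpush_beta_kernel alpha beta gamma phi t =
  expR (ln_rpush_beta_kernel alpha beta gamma phi t).
Proof.
move=> p01 [/andP[t0 t1]|[-> ->]]; rewrite /rpush_beta_kernel /ln_rpush_beta_kernel.
  have L0 : 0 < 1 - phi + t * phi.
    by rewrite (lt_le_trans t0)// le_push_factor// ltW.
  by rewrite !expRD /powR !gt_eqF// subr_gt0.
have -> : 1 - phi + 1 * phi = 1 by rewrite mul1r subrK.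
by rewrite ln1 !mulr0 subrr mul0r !addr0 expR0 powRr0 powR1 !mulr1.
Qed.

Lemma is_derive_ln_affine (c d t : R) : 0 < c + t * d ->
  is_derive t 1 (fun t => ln (c + t * d)) (d / (c + t * d)).
Proof.
move=> h; rewrite [d / _]mulrC.
exact: (@is_derive1_comp _ (@ln R) (fun t => c + t * d) _ _ _ (is_derive1_ln h)
  (is_derive_affine c d t)).
Qed.

Lemma is_derive_ln_rpush_beta_kernel alpha beta gamma phi t :
  0 <= phi <= 1 -> 0 < t < 1 ->
  is_derive t 1 (ln_rpush_beta_kernel alpha beta gamma phi)
    (dln_rpush_beta_kernel alpha beta gamma phi t).
Proof.
move=> p01 /andP[t0 t1].
have scale (f : R -> R) (c d : R) : is_derive t 1 f d ->
    is_derive t 1 (fun t => c * f t) (c * d).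
  by move=> fd; exact: (is_deriveZ c fd).
have -> : ln_rpush_beta_kernel alpha beta gamma phi =
    (fun t => (alpha - 1) * ln (0 + t * 1)) \+
    (fun t => (beta - 1) * ln (1 + t * -1)) \+
    (fun t => gamma * ln (1 - phi + t * phi)).
  by apply/funext => u; rewrite /= add0r mulr1 mulrN1.
have -> : dln_rpush_beta_kernel alpha beta gamma phi t =
    (alpha - 1) * (1 / (0 + t * 1)) + (beta - 1) * (-1 / (1 + t * -1)) +
    gamma * (phi / (1 - phi + t * phi)).
  by rewrite /dln_rpush_beta_kernel add0r mulr1 mulrN1 mulN1r mulrN div1r.
apply: is_deriveD; first apply: is_deriveD.
- by apply: scale; apply: is_derive_ln_affine; rewrite add0r mulr1.
- by apply: scale; apply: is_derive_ln_affine; rewrite mulrN1 subr_gt0.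
- apply: scale; apply: is_derive_ln_affine.
  by rewrite (lt_le_trans t0)// le_push_factor// ltW.
Qed.

Lemma continuous_ln_rpush_beta_kernel alpha beta gamma phi t :
  0 <= phi <= 1 -> 0 < t < 1 \/ t = 1 /\ beta = 1 ->
  {for t, continuous (ln_rpush_beta_kernel alpha beta gamma phi)}.
Proof.
move=> p01 [t01|[-> ->]].
  have [+ _] := is_derive_ln_rpush_beta_kernel alpha beta gamma p01 t01.
  by move/derivable1_diffP/differentiable_continuous.
have -> : ln_rpush_beta_kernel alpha 1 gamma phi =
    (fun t : R => (alpha - 1) * ln t + gamma * ln (1 - phi + t * phi)).
  by apply/funext => s; rewrite /ln_rpush_beta_kernel subrr mul0r addr0.
have h : (0 : R) < 1 - phi + 1 * phi by rewrite mul1r subrK.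
apply: cvgD; apply: cvgM; try exact: cvg_cst; first exact: continuous_ln.
have [+ _] := is_derive_ln_affine h.
by move/derivable1_diffP/differentiable_continuous.
Qed.

(* Since [t <= 1 - phi + t * phi =: L t], the loss [gamma * phi ^+ 2 / (L s * L t)]
   in the difference quotient is absorbed by [(1 - alpha) / (s * t)]. *)
Lemma dln_rpush_beta_kernel_increasing alpha beta gamma phi s t :
  0 <= phi <= 1 -> 0 <= gamma -> beta <= 1 -> alpha + gamma * phi ^+ 2 < 1 ->
  0 < s -> s < t -> t < 1 ->
  dln_rpush_beta_kernel alpha beta gamma phi s <
  dln_rpush_beta_kernel alpha beta gamma phi t.
Proof.
move=> p01 g0 b1 agp s0 st t1.
have t0 := lt_trans s0 st; have s1 := lt_trans st t1.
have sL := le_push_factor p01 (ltW s1).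
have tL := le_push_factor p01 (ltW t1).
have sL0 := lt_le_trans s0 sL; have tL0 := lt_le_trans t0 tL.
have s1' : 0 < 1 - s by rewrite subr_gt0.
have t1' : 0 < 1 - t by rewrite subr_gt0.
rewrite -subr_gt0 /dln_rpush_beta_kernel.
set Ls := 1 - phi + s * phi in sL sL0 *.
set Lt := 1 - phi + t * phi in tL tL0 *.
rewrite (_ : _ - _ = (t - s) * ((1 - alpha) / (s * t) +
  (1 - beta) / ((1 - s) * (1 - t)) - gamma * phi ^+ 2 / (Ls * Lt))); last first.
  by rewrite /Ls /Lt; field; rewrite !gt_eqF.
rewrite mulr_gt0 ?subr_gt0//.
have hb : 0 <= (1 - beta) / ((1 - s) * (1 - t)).
  by rewrite divr_ge0 ?subr_ge0// mulr_ge0// ltW.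
have gp0 : 0 <= gamma * phi ^+ 2 by rewrite mulr_ge0// sqr_ge0.
have hL : gamma * phi ^+ 2 / (Ls * Lt) <= gamma * phi ^+ 2 / (s * t).
  by rewrite ler_wpM2l// lef_pV2 ?posrE ?mulr_gt0// ler_pM// ltW.
have : gamma * phi ^+ 2 / (s * t) < (1 - alpha) / (s * t).
  by rewrite ltr_pM2r ?invr_gt0 ?mulr_gt0//; lra.
by lra.
Qed.

(** The hypotheses on [x] and [y] leave out the end points where the density is infinite: always 0,
    and also 1 when [beta < 1]. *)
Lemma rpush_beta_kernel_lt_max alpha beta gamma phi x m y :
  0 <= phi <= 1 -> 0 <= gamma -> beta <= 1 -> alpha + gamma * phi ^+ 2 < 1 ->
  0 < x -> x < m < y -> y < 1 \/ y = 1 /\ beta = 1 ->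
  rpush_beta_kernel alpha beta gamma phi m <
  Num.max (rpush_beta_kernel alpha beta gamma phi x)
          (rpush_beta_kernel alpha beta gamma phi y).
Proof.
move=> p01 g0 b1 agp x0 xmy yb; have /andP[xm my] := xmy.
have y1 : y <= 1 by case: yb => [/ltW|[->]].
rewrite !rpush_beta_kernel_expR//; last 3 first.
- by case: yb => [y_lt1|]; [left; lra|right].
- by left; lra.
- by left; lra.
rewrite lt_max !ltr_expR -lt_max.
apply: (lt_max_of_increasing_derive xmy
  (df := dln_rpush_beta_kernel alpha beta gamma phi)).
- move=> t; rewrite in_itv/= => /andP[xt ty].
  by apply: is_derive_ln_rpush_beta_kernel => //; lra.
- move=> t; rewrite in_itv/= => /andP[xt ty].
  apply: continuous_ln_rpush_beta_kernel => //.
  have [t1|t1] := ltP t 1; first by left; lra.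
  have -> : t = 1 by lra.
  by case: yb => [|[_ ->]]; [lra|right].
- move=> s t; rewrite !in_itv/= => /andP[xs sy] /andP[xt ty] st.
  by apply: dln_rpush_beta_kernel_increasing => //; lra.
Qed.

Lemma cvgy_powRN (F : set_system R) (h : R -> R) (s c : R) :
  Filter F -> 0 < s -> 0 < c -> (\forall t \near F, 0 < h t) ->
  h t @[t --> F] --> 0 -> c * h t `^ (- s) @[t --> F] --> +oo.
Proof.
move=> FF s0 c0 h0 hcvg; apply: gt0_cvgMry => //.
have -> : (fun t => h t `^ (- s)) = (fun t => (h t `^ s)^-1).
  by apply/funext => t; rewrite /= powRN.
apply/cvgrVy.
  by near=> t; rewrite powR_gt0//; near: t.
have := cvg_comp _ _ hcvg (@continuous_normr_powR R s (ltW s0) 0).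
rewrite normr0 powR0 ?gt_eqF//; apply: cvg_trans.
apply: near_eq_cvg; near=> t; rewrite /= gtr0_norm//.
by near: t.
Unshelve. all: by end_near. Qed.

Lemma rpush_beta_0 alpha beta gamma phi :
  0 < alpha -> 0 < beta ->
  0 <= phi <= 1 -> 0 <= gamma -> beta <= 1 -> alpha + gamma * phi ^+ 2 < 1 ->
  rpush_beta alpha beta gamma phi 0 = +oo%E.
Proof.
move=> a0 b0 p01 g0 b1 agp; rewrite /rpush_beta eqxx.
apply/cvg_lim => //; apply/cvgeryP.
have Z0 := Rintegral_rpush_beta_kernel_gt0 a0 b0 g0 p01.
pose c : R := if phi == 1 then 1 else (1 - phi) `^ gamma.
have /andP[p0 p1] := p01.
have c0 : 0 < c.
  rewrite /c; case: eqVneq => // pneq1; rewrite powR_gt0// subr_gt0.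
  by rewrite lt_neqAle pneq1.
have s0 : 0 < 1 - (alpha + gamma * phi ^+ 2) by rewrite subr_gt0.
have c0Z := divr_gt0 c0 Z0.
have cvgy : c / Rintegral lebesgue_measure `[0, 1]
      (rpush_beta_kernel alpha beta gamma phi) *
    t `^ (- (1 - (alpha + gamma * phi ^+ 2))) @[t --> 0^'+] --> +oo.
  apply: (@cvgy_powRN _ id) => //; first exact: nbhs_right_gt.
  by apply: cvg_at_right_filter; exact: cvg_id.
apply: ger_cvgy cvgy; near=> t.
have t0 : 0 < t by near: t; exact: nbhs_right_gt.
have t1 : t < 1 by near: t; exact: nbhs_right_lt.
rewrite /rpush_beta_interior mulrAC ler_pM2r ?invr_gt0//.
have -> : - (1 - (alpha + gamma * phi ^+ 2)) = alpha - 1 + gamma * phi ^+ 2.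
  by ring.
rewrite powRD ?(gt_eqF t0) ?implybT// /rpush_beta_kernel mulrCA -[leRHS]mulrA.
rewrite ler_pM2l ?powR_gt0// (@le_trans _ _ ((1 - phi + t * phi) `^ gamma))//.
  rewrite /c; case: eqVneq => [->|pneq1].
    by rewrite subrr add0r expr1n !mulr1 mul1r.
  rewrite (@le_trans _ _ ((1 - phi) `^ gamma))//.
    rewrite ler_piMr ?powR_ge0// -[leRHS](powRr0 t) ger_powR ?t0 ?(ltW t1)//.
    by rewrite mulr_ge0// sqr_ge0.
  have tp0 : 0 <= t * phi by rewrite mulr_ge0// ltW.
  by rewrite ge0_ler_powR ?nnegrE ?lerDl ?subr_ge0// addr_ge0 ?subr_ge0.
(* The remaining factor has base in []0, 1]] and a nonpositive exponent, hence is at least 1. *)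
rewrite ler_peMl ?powR_ge0// -[leLHS](powRr0 (1 - t)) ger_powR ?subr_le0//.
by rewrite subr_gt0 t1/= gerBl ltW.
Unshelve. all: by end_near. Qed.

(** For [t > 1/2] the push factor is at least [t], hence above one half, and the power of [t] is at
    least 1 because [alpha <= 1]. What remains is a constant times a negative power of [1 - t]. *)
Lemma rpush_beta_1 alpha beta gamma phi :
  0 < alpha -> 0 < beta -> 0 <= phi <= 1 -> 0 <= gamma -> alpha <= 1 ->
  beta < 1 -> rpush_beta alpha beta gamma phi 1 = +oo%E.
Proof.
move=> a0 b0 p01 g0 a1 b1; rewrite /rpush_beta oner_eq0 eqxx.
apply/cvg_lim => //; apply/cvgeryP.
have Z0 := Rintegral_rpush_beta_kernel_gt0 a0 b0 g0 p01.
have half0 : 0 < (2^-1 : R) by rewrite invr_gt0.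
have c0 : 0 < (2^-1 : R) `^ gamma by exact: powR_gt0.
have s0 : 0 < 1 - beta by rewrite subr_gt0.
have c0Z := divr_gt0 c0 Z0.
have cvgy : 2^-1 `^ gamma / Rintegral lebesgue_measure `[0, 1]
      (rpush_beta_kernel alpha beta gamma phi) *
    (1 - t) `^ (- (1 - beta)) @[t --> 1^'-] --> +oo.
  apply: (@cvgy_powRN _ (fun t => 1 - t)) => //.
    by near=> t; rewrite subr_gt0; near: t; exact: nbhs_left_lt.
  apply: cvg_at_left_filter; rewrite -[X in _ --> X](subrr 1).
  by apply: cvgB; [exact: cvg_cst|exact: cvg_id].
apply: ger_cvgy cvgy; near=> t.
have t2 : 2^-1 < t by near: t; apply: nbhs_left_gt; rewrite invf_lt1// ltr1n.
have t1 : t < 1 by near: t; exact: nbhs_left_lt.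
have t0 := lt_trans half0 t2.
rewrite /rpush_beta_interior mulrAC ler_pM2r ?invr_gt0// opprB.
rewrite /rpush_beta_kernel mulrC [_ `^ _ * _ `^ _ in leRHS]mulrC -[leRHS]mulrA.
rewrite ler_wpM2l ?powR_ge0// (@le_trans _ _ ((1 - phi + t * phi) `^ gamma))//.
  have tL := le_push_factor p01 (ltW t1).
  rewrite ge0_ler_powR ?nnegrE ?(ltW half0) ?(le_trans (ltW t0) tL)//.
  by rewrite (le_trans (ltW t2) tL).
rewrite ler_peMl ?powR_ge0// -[leLHS](powRr0 t) ger_powR ?subr_le0//.
by rewrite t0 ltW.
Unshelve. all: by end_near. Qed.

(** Here [alpha] may be below 1, so the kernel need not be continuous at 0; continuity at 1 alone is
    obtained from its logarithm. *)
Lemma rpush_beta_1E alpha gamma phi : 0 <= phi <= 1 ->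
  rpush_beta alpha 1 gamma phi 1 = (rpush_beta_interior alpha 1 gamma phi 1)%:E.
Proof.
move=> p01; rewrite /rpush_beta oner_eq0 eqxx.
apply/cvg_lim => //; apply: cvg_EFin; first exact: nearW.
rewrite /rpush_beta_interior; apply: cvgM; last exact: cvg_cst.
have b1 : 0 < (1 : R) < 1 \/ (1 : R) = 1 /\ (1 : R) = 1 by right.
rewrite rpush_beta_kernel_expR//.
have /cvg_at_left_filter cl :=
  continuous_ln_rpush_beta_kernel (alpha := alpha) (gamma := gamma) p01 b1.
have := cvg_comp _ _ cl (@continuous_expR R _); apply: cvg_trans.
apply: near_eq_cvg; near=> t; rewrite rpush_beta_kernel_expR//; left.
by apply/andP; split; near: t; [exact: nbhs_left_gt|exact: nbhs_left_lt].
Unshelve. all: by end_near. Qed.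

Lemma strictly_quasi_convex_rpush_beta alpha beta gamma phi :
  0 < alpha -> 0 < beta -> 0 <= phi <= 1 -> 0 <= gamma -> beta <= 1 ->
  alpha + gamma * phi ^+ 2 < 1 ->
  strictly_quasi_convex_on `[0, 1] (rpush_beta alpha beta gamma phi).
Proof.
move=> a0 b0 p01 g0 b1 agp.
(* It suffices to treat ordered end points and a point strictly between them, which is then interior
   to the support and has a finite density. *)
have main x m y : 0 <= x -> x < m < y -> y <= 1 ->
    (rpush_beta alpha beta gamma phi m <
     Order.max (rpush_beta alpha beta gamma phi x)
               (rpush_beta alpha beta gamma phi y))%E.
  move=> x0 xmy y1; have /andP[xm my] := xmy.
  rewrite rpush_beta_itvooE; last by lra.
  rewrite lt_max; have [->|xneq0] := eqVneq x 0.
    by rewrite rpush_beta_0// ltry.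
  have {}x0 : 0 < x by rewrite lt_neqAle eq_sym xneq0.
  rewrite [rpush_beta _ _ _ _ x]rpush_beta_itvooE; last by lra.
  have [/andP[/eqP -> blt1]|ynb] := boolP ((y == 1) && (beta < 1)).
    rewrite [rpush_beta _ _ _ _ 1]rpush_beta_1 ?ltry ?orbT//.
    by rewrite (le_trans _ (ltW agp))// lerDl mulr_ge0// sqr_ge0.
  have yb : y < 1 \/ y = 1 /\ beta = 1.
    have [ylt1|yge1] := ltP y 1; first by left.
    have yE : y = 1 by apply/le_anti; rewrite y1.
    right; split=> //; apply/le_anti; rewrite b1 leNgt.
    by move: ynb; rewrite yE eqxx.
  have -> : rpush_beta alpha beta gamma phi y =
      (rpush_beta_interior alpha beta gamma phi y)%:E.
    case: yb => [ylt1|[-> ->]]; last exact: rpush_beta_1E.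
    by rewrite rpush_beta_itvooE//; lra.
  rewrite !lte_fin -lt_max.
  have Z0 := Rintegral_rpush_beta_kernel_gt0 a0 b0 g0 p01.
  rewrite /rpush_beta_interior -maxr_pMl ?invr_ge0 ?(ltW Z0)//.
  by rewrite ltr_pM2r ?invr_gt0//; exact: rpush_beta_kernel_lt_max.
move=> x y l; rewrite /= !in_itv/= => /andP[x0 x1] /andP[y0 y1] xy /andP[l0 l1].
have := xy; rewrite neq_lt => /orP[lt|lt].
  by apply: main => //; apply/andP; split; nra.
(* When [y < x], the end points exchange roles. *)
by rewrite maxC; apply: main => //; apply/andP; split; nra.
Qed.

End quasi_convexity.

Theorem mainTheorem8 (R : realType) (alpha beta phi : R)
    (alpha_gt0 : 0 < alpha) (beta_gt0 : 0 < beta) (phi01 : 0 <= phi <= 1) :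
  (forall gamma : R, 0 <= gamma ->
     [/\ (1 <= beta -> 1 < alpha ->
            strictly_quasi_concave_on `[0, 1]
              (rpush_beta alpha beta gamma phi)),
         (1 < beta -> 1 <= alpha ->
            strictly_quasi_concave_on `[0, 1]
              (rpush_beta alpha beta gamma phi)),
         (1 <= beta -> 1 <= alpha -> 0 < gamma -> 0 < phi ->
            strictly_quasi_concave_on `[0, 1]
              (rpush_beta alpha beta gamma phi))
       & (beta <= 1 -> alpha + gamma * phi ^+ 2 < 1 ->
            strictly_quasi_convex_on `[0, 1]
              (rpush_beta alpha beta gamma phi))]) /\
  (beta <= 1 -> alpha < 1 -> 0 < phi < 1 ->
     exists2 gamma_star : R, 0 < gamma_star &
       forall gamma : R, 0 <= gamma -> gamma < gamma_star ->
         strictly_quasi_convex_on `[0, 1]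
           (rpush_beta alpha beta gamma phi)).
Proof.
split=> [gamma gamma_ge0|beta_le1 alpha_lt1 /andP[phi_gt0 phi_lt1]].
  split.
  - move=> b1 a1; apply: strictly_quasi_concave_rpush_beta => //.
    + exact: ltW.
    + by rewrite a1.
  - move=> b1 a1; apply: strictly_quasi_concave_rpush_beta => //.
    + exact: ltW.
    + by rewrite b1 orbT.
  - move=> b1 a1 g1 p1; apply: strictly_quasi_concave_rpush_beta => //.
    by rewrite g1 p1 !orbT.
  - by move=> b1 agp; exact: strictly_quasi_convex_rpush_beta.
have phi2_gt0 : 0 < phi ^+ 2 by rewrite exprn_gt0.
exists ((1 - alpha) / phi ^+ 2); first by rewrite divr_gt0// subr_gt0.
move=> gamma gamma_ge0; rewrite ltr_pdivlMr// => gamma_small.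
by apply: strictly_quasi_convex_rpush_beta => //; rewrite addrC -ltrBrDr.
Qed.
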